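(* Let $n,q$ be positive integers with $q<n$, let $A\in\mathbb{R}^{n\times n}$ and $B\in\mathbb{R}^{n\times q}$. Assume that all eigenvalues of $A$ lie in the open left half plane $\mathbb{C}^-$ and that $W(A)$ has nonempty intersection with the open right half plane. Let $$\mathcal{M}=\begin{bmatrix} -(A+A^T) & B\\ B^T & 0\end{bmatrix}\in\mathbb{R}^{(n+q)\times(n+q)}.$$ Then there exists a matrix $K\in\mathbb{R}^{q\times n}$ such that $W(A-BK)\subset\mathbb{C}^-$ if and only if the pencil $(\mathcal{M},\mathcal{D})$ admits $n$ positive eigenvalues for some symmetric and positive definite matrix $\mathcal{D}\in\mathbb{R}^{(n+q)\times(n+q)}$.
   Context: For $M\in\mathbb{R}^{n\times n}$, the field of values is $W(M)=\{x^*Mx : x\in\mathbb{C}^n,\ \|x\|=1\}$ with $\|x\|$ the Euclidean norm. $\mathbb{C}^-$ is the open left half complex plane. The eigenvalues of the pencil $(\mathcal{M},\mathcal{D})$ are the scalars $\lambda$ such that $\mathcal{M}v=\lambda\mathcal{D}v$ for some nonzero $v$, counted with multiplicity. *)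

(* Defs.v *)
From mathcomp Require Import all_boot all_order all_algebra.
From mathcomp Require Import classical_sets reals.
From mathcomp.real_closed Require Import complex.

Set Implicit Arguments.
Unset Strict Implicit.
Unset Printing Implicit Defensive.

Import Order.TTheory GRing.Theory Num.Theory.
Local Open Scope ring_scope.
Local Open Scope classical_set_scope.
Local Open Scope complex_scope.
Local Open Scope sesquilinear_scope.

(* In this file [complex.Re z : R] is the real part of z : R[i], whereas
   ['Re z] would have type R[i]; the order on R[i] is the partial order for
   which 0 < z means that z is real and positive. *)

Definition open_left_half_plane (R : realType) : set R[i] :=
  [set z | complex.Re z < 0].

Definition open_right_half_plane (R : realType) : set R[i] :=
  [set z | 0 < complex.Re z].

(* The norm of 'cV[R[i]]_n in MathComp-Analysis is the sup norm, hence this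
   separate Euclidean norm. *)
Definition euclidean_norm (R : realType) n (x : 'cV[R[i]]_n) : R[i] :=
  sqrtC (\sum_(i < n) `|x i 0| ^+ 2).

Definition complexify (R : realType) m n (M : 'M[R]_(m, n)) : 'M[R[i]]_(m, n) :=
  map_mx (real_complex R) M.

Definition field_of_values (R : realType) n (M : 'M[R]_n) : set R[i] :=
  [set z | exists2 x : 'cV[R[i]]_n, euclidean_norm x = 1
                                  & z = (x ^t* *m complexify M *m x) 0 0].

Definition posdefmx (R : realType) n (D : 'M[R]_n) : Prop :=
  forall x : 'cV[R]_n, x != 0 -> 0 < (x^T *m D *m x) 0 0.

Definition pencil_eigenvalue (F : fieldType) n (M D : 'M[F]_n) (a : F) : Prop :=
  exists2 v : 'cV[F]_n, v != 0 & M *m v = a *: (D *m v).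

Definition pencil_poly (F : fieldType) n (M D : 'M[F]_n) : {poly F} :=
  \det (map_mx polyC M - 'X *: map_mx polyC D).

Lemma pencil_eigenvalue_root (F : fieldType) n (M D : 'M[F]_n) (a : F) :
  pencil_eigenvalue M D a <-> root (pencil_poly M D) a.
Proof.
have evE : (pencil_poly M D).[a] = \det (M - a *: D).
  rewrite /pencil_poly -horner_evalE -det_map_mx; congr (\det _).
  apply/matrixP=> i j; rewrite !mxE /= /horner_eval.
  by rewrite hornerD hornerN hornerM hornerX !hornerC.
rewrite /root evE -det_tr; split.
  move=> [v v0 Mv]; apply/det0P; exists v^T; first by rewrite trmx_eq0.
  by rewrite -trmx_mul mulmxBl Mv -scalemxAl subrr trmx0.
move=> /det0P[v v0 vM]; exists v^T; first by rewrite trmx_eq0.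
apply/eqP; rewrite -subr_eq0 scalemxAl -mulmxBl; apply/eqP/trmx_inj.
by rewrite trmx_mul trmxK vM trmx0.
Qed.

(* Eigenvalues are counted with algebraic multiplicity, i.e., with their
   multiplicity as roots of det (M - X D); s lists the distinct positive
   eigenvalues. *)
Definition has_positive_eigenvalues (R : realType) m (M D : 'M[R]_m) (k : nat)
    : Prop :=
  exists s : seq R[i],
    [/\ uniq s,
        forall a, a \in s <->
          pencil_eigenvalue (complexify M) (complexify D) a /\ 0 < a
      & (\sum_(a <- s) mup a (pencil_poly (complexify M) (complexify D)))%N = k].

(* Main.v *)
Require Import Defs.
From mathcomp Require Import all_boot all_order all_algebra.
From mathcomp Require Import lra.
From mathcomp Require Import classical_sets reals.
From mathcomp.real_closed Require Import complex.

(** Put [H := - (A + A^T)].  For a real matrix [N] the real part of [x^* N x] is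
half of [x^* (N + N^T) x], so [W(A - B K)] lies in the open left half plane
exactly when the real symmetric matrix [H + B K + (B K)^T] is positive definite
([field_of_values_left]).  Both sides of the equivalence amount to positivity
of [H] on the kernel of [B^T].

On the pencil side, a congruence turns the positive definite [D] into the
identity and [M] into a real diagonal matrix ([simultaneous_diagonalization]),
so the positive eigenvalues of the pencil, counted with multiplicity, are the
positive entries of the diagonal: their number [p] is the positive index of
inertia of [M] whatever [D] is.  As in Sylvester's law, [p] bounds the dimension
of every subspace on which [M] is positive definite, and [m - p], where [m] is
the size of [M], that of every subspace on which [M] is negative semidefinite
([positive_inertia]).  Three subspaces then settle everything.
- The vectors [(0, y)] are isotropic for [M], so [p <= n] always.
- On the graph [(x, K x)] the form of [M] is that of [H + B K + (B K)^T], so a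
  stabilizing [K] forces [n <= p].
- If [x] is a nonzero vector with [B^T x = 0] and [x^T H x <= 0], then [M] is
  negative semidefinite on the vectors [(t x, y)], which have dimension [q + 1],
  so [p < n].  Thus [p = n] makes [H] positive on the kernel of [B^T].

It remains to get [K] from positivity of [H] on that kernel, a form of Finsler's
lemma, for which [finsler_feedback] writes down a [K]. *)

Set Implicit Arguments.
Unset Strict Implicit.
Unset Printing Implicit Defensive.

Import Order.TTheory GRing.Theory Num.Theory.
Local Open Scope ring_scope.
Local Open Scope sesquilinear_scope.

(** * Hermitian forms and their diagonalization *)

Definition hermitian_form {C : numClosedFieldType} {m} (M : 'M[C]_m)
  (x : 'cV[C]_m) : C := (x ^t* *m M *m x) 0 0.

Definition hermitian_posdef {C : numClosedFieldType} {m} (M : 'M[C]_m) : Prop :=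
  forall x, x != 0 -> 0 < hermitian_form M x.

Section HermitianForm.
Variable C : numClosedFieldType.

Lemma trmxC_mul m n p (A : 'M[C]_(m, n)) (B : 'M[C]_(n, p)) :
  (A *m B) ^t* = B ^t* *m A ^t*.
Proof. by rewrite trmx_mul map_mxM. Qed.

Lemma hermitian_form_mul m n (M : 'M[C]_m) (E : 'M[C]_(m, n)) x :
  hermitian_form M (E *m x) = hermitian_form (E ^t* *m M *m E) x.
Proof. by rewrite /hermitian_form trmxC_mul !mulmxA. Qed.

Lemma hermitian_form_conj m (M : 'M[C]_m) x :
  (hermitian_form M x)^* = hermitian_form (M ^t*) x.
Proof.
have -> : (hermitian_form M x)^* = ((x ^t* *m M *m x) ^t*) 0 0.
  by rewrite [RHS]mxE [in RHS]mxE.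
by rewrite !trmxC_mul trmxCK mulmxA.
Qed.

Lemma hermitian_form_scale m (M : 'M[C]_m) a x :
  hermitian_form M (a *: x) = `|a| ^+ 2 * hermitian_form M x.
Proof.
rewrite /hermitian_form [(a *: x)^T]linearZ /= map_mxZ -!scalemxAl.
rewrite -scalemxAr scalerA !mxE.
by rewrite normCK [a * _]mulrC.
Qed.

Lemma hermitian_form_diag m (d : 'rV[C]_m) (w : 'cV[C]_m) :
  hermitian_form (diag_mx d) w = \sum_i d 0 i * `|w i 0| ^+ 2.
Proof.
rewrite /hermitian_form mul_mx_diag mxE; apply: eq_bigr => i _.
by rewrite !mxE normCK mulrAC mulrC [_^* * _]mulrC.
Qed.

Lemma hermitian_diagonalization m (M : 'M[C]_m) : M ^t* = M ->
  exists2 Q : 'M[C]_m, Q *m Q ^t* = 1%:M /\ Q ^t* *m Q = 1%:M &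
  exists2 d : 'rV[C]_m, (forall i, d 0 i \is Num.real) &
    Q ^t* *m M *m Q = diag_mx d.
Proof.
move=> Mh; have Mherm : M \is hermsymmx.
  by apply/is_hermitianmxP; rewrite expr0 scale1r Mh.
have dreal := mxOverP (hermitian_spectral_diag_real Mherm).
have /hermitian_normalmx /orthomx_spectralP ME := Mherm.
have Pu := spectral_unitarymx M; move: (Pu) (unitarymx_unit Pu) ME dreal.
set P := spectralmx M; set d := spectral_diag M => Pun Punit ME dreal.
have PE := invmx_unitary Pun.
exists (P ^t*); rewrite ?trmxCK -?PE ?mulmxV ?mulVmx //.
exists d; first by move=> i; apply: dreal.
by rewrite {1}ME !mulmxA mulmxV // mul1mx mulmxK.
Qed.

(** Diagonalize [D] unitarily and rescale the eigenbasis to make [D] the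
identity; the Hermitian matrix that [M] has become is then diagonalized by a
second unitary matrix, which leaves the identity unchanged. *)
Lemma simultaneous_diagonalization m (M D : 'M[C]_m) :
  M ^t* = M -> D ^t* = D -> hermitian_posdef D ->
  exists2 T : 'M[C]_m, T \in unitmx & exists2 d : 'rV[C]_m,
    (forall i, d 0 i \is Num.real) &
    T ^t* *m M *m T = diag_mx d /\ T ^t* *m D *m T = 1%:M.
Proof.
move=> Mh Dh Dpos.
have [P [PP' P'P] [e _ De]] := hermitian_diagonalization Dh.
have Punit : P \in unitmx by case: (mulmx1_unit PP').
(* The diagonal entry [e 0 i] is the value of the form at the eigenvector
   [P *m delta_mx i 0]. *)
have e_gt0 i : 0 < e 0 i.
  have : P *m delta_mx i 0 != 0 :> 'cV_m.
    apply/eqP => /(congr1 (mulmx (invmx P))); rewrite mulKmx // mulmx0.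
    by move=> /matrixP/(_ i 0)/eqP; rewrite !mxE !eqxx oner_eq0.
  move/Dpos; rewrite hermitian_form_mul De hermitian_form_diag.
  rewrite (bigD1 i) //= big1 => [|j ji]; rewrite !mxE ?eqxx /=.
    by rewrite normr1 expr1n mulr1 addr0.
  by rewrite (negPf ji) normr0 expr0n mulr0.
pose r := \row_i (sqrtC (e 0 i))^-1.
pose S := P *m diag_mx r.
have rt : (diag_mx r) ^t* = diag_mx r.
  apply/matrixP=> i j; rewrite !mxE; case: (altP (j =P i)) => [->|ji].
    rewrite eqxx !mulr1n; apply/CrealP/ger0_real.
    by rewrite invr_ge0 sqrtC_ge0 ltW.
  by rewrite eq_sym (negPf ji) rmorph0.
have SDS : S ^t* *m D *m S = 1%:M.
  have -> : S ^t* *m D *m S = diag_mx r *m (P ^t* *m D *m P) *m diag_mx r.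
    by rewrite trmxC_mul rt !mulmxA.
  rewrite De.
  rewrite !mulmx_diag; apply/matrixP=> i j; rewrite !mxE.
  case: (altP (i =P j)) => // ->; rewrite mulrC mulrA -expr2 exprVn sqrtCK.
  by rewrite mulVf // gt_eqF.
have Nh : (S ^t* *m M *m S) ^t* = S ^t* *m M *m S.
  by rewrite trmxC_mul [X in _ *m X]trmxC_mul trmxCK Mh mulmxA.
have [Q [QQ' Q'Q] [d dreal Md]] := hermitian_diagonalization Nh.
exists (S *m Q).
  have [_ Sunit] := mulmx1_unit SDS; have [Qunit _] := mulmx1_unit QQ'.
  by rewrite unitmx_mul Sunit Qunit.
exists d => //; rewrite trmxC_mul; split; first by rewrite -Md !mulmxA.
by rewrite -Q'Q -[in RHS](mulmx1 (Q ^t*)) -SDS !mulmxA.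
Qed.

End HermitianForm.

(** * Inertia of a diagonalized form *)

Definition positive_indices {F : numDomainType} {m} (d : 'rV[F]_m) :
    {set 'I_m} :=
  [set i | 0 < d 0 i].

Section Inertia.

(** Fewer than [k] linear conditions on [k] unknowns have a nonzero solution:
this is the intersection argument behind both inertia bounds. *)
Lemma vanishing_combination (F : fieldType) m k (W : 'M[F]_(m, k))
    (S : {set 'I_m}) : (#|S| < k)%N ->
  exists2 x : 'cV[F]_k, x != 0 & forall i, i \in S -> (W *m x) i 0 = 0.
Proof.
move=> ltSk; pose WS := (rowsub (enum_val : 'I_#|S| -> 'I_m) W)^T.
have : kermx WS != 0.
  by rewrite kermx_eq0 -row_leq_rank -ltnNge (leq_ltn_trans (rank_leq_col _)).
move/rowV0Pn=> [v /sub_kermxP vK v0]; exists v^T; first by rewrite trmx_eq0.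
move=> i iS; have : (v *m WS) 0 (enum_rank_in iS i) = 0 by rewrite vK mxE.
rewrite !mxE => {2}<-; apply: eq_bigr => j _.
by rewrite !mxE enum_rankK_in // mulrC.
Qed.

Variables (C : numClosedFieldType) (m : nat) (M T : 'M[C]_m) (d : 'rV[C]_m).
Hypotheses (Tunit : T \in unitmx) (dreal : forall i, d 0 i \is Num.real).
Hypothesis MT : T ^t* *m M *m T = diag_mx d.

Lemma congruence_coordinates x :
  hermitian_form M x = \sum_i d 0 i * `|(invmx T *m x) i 0| ^+ 2.
Proof. by rewrite -hermitian_form_diag -MT -hermitian_form_mul mulKVmx. Qed.

(** With fewer positive diagonal entries than columns of [E], some nonzero
vector of the subspace has zero coordinates at all of them, and there the form
is nonpositive. *)
Lemma posdef_subspace_bound k (E : 'M[C]_(m, k)) :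
  (forall x, x != 0 -> 0 < hermitian_form M (E *m x)) ->
  (k <= #|positive_indices d|)%N.
Proof.
move=> Epos; rewrite leqNgt; apply/negP => ltk.
have [x x0 xS] := vanishing_combination (invmx T *m E) ltk.
have := Epos x x0; rewrite congruence_coordinates => /lt_le_trans sum_gt0.
suff /sum_gt0 : \sum_i d 0 i * `|(invmx T *m (E *m x)) i 0| ^+ 2 <= 0.
  by rewrite ltxx.
apply: sumr_le0 => i _; rewrite mulmxA.
case: (boolP (0 < d 0 i)) => [di|].
  by rewrite xS ?inE // normr0 expr0n mulr0.
by rewrite -real_leNgt // => di; rewrite mulr_le0_ge0 // exprn_ge0.
Qed.

(** Dually, if the subspace were too large it would contain a nonzero vector
supported on the positive entries, where the form is positive. *)
Lemma nonpos_subspace_bound k (E : 'M[C]_(m, k)) :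
  (forall x : 'cV_k, E *m x = 0 -> x = 0) ->
  (forall x, hermitian_form M (E *m x) <= 0) ->
  (k + #|positive_indices d| <= m)%N.
Proof.
move=> Einj Eneg; rewrite addnC -leq_subRL; last first.
  by rewrite -[X in (_ <= X)%N](card_ord m) max_card.
have -> : (m - #|positive_indices d|)%N = #|~: positive_indices d|.
  by rewrite -[X in (X - _)%N]card_ord -(cardsC (positive_indices d)) addKn.
rewrite leqNgt; apply/negP => ltk.
have [x x0 xS] := vanishing_combination (invmx T *m E) ltk.
have w_eq0 i : ~~ (0 < d 0 i) -> (invmx T *m (E *m x)) i 0 = 0.
  by move=> di; rewrite mulmxA xS // !inE.
have term_ge0 i : 0 <= d 0 i * `|(invmx T *m (E *m x)) i 0| ^+ 2.
  case: (boolP (0 < d 0 i)) => di; first by rewrite mulr_ge0 ?exprn_ge0 // ltW.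
  by rewrite w_eq0 // normr0 expr0n mulr0.
have := Eneg x; rewrite congruence_coordinates => sum_le0.
have /psumr_eq0P w0 : \sum_i d 0 i * `|(invmx T *m (E *m x)) i 0| ^+ 2 = 0.
  by apply/le_anti; rewrite sum_le0 sumr_ge0.
case/eqP: x0; apply: Einj; rewrite -[E *m x](mulKVmx Tunit).
suff -> : invmx T *m (E *m x) = 0 by rewrite mulmx0.
apply/colP=> i; rewrite [RHS]mxE.
case: (boolP (0 < d 0 i)) => [di|/w_eq0 //].
have /eqP := w0 (fun i _ => term_ge0 i) i isT.
by rewrite mulf_eq0 gt_eqF //= expf_eq0 normr_eq0 => /eqP.
Qed.

End Inertia.

(** * Pencils diagonalized by a congruence *)

Section PencilPolynomial.
Variables (F : fieldType) (m : nat).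

(** Equivalence of pencils only changes the polynomial by a constant, so it
keeps the roots and their multiplicities. *)
Lemma pencil_poly_congr (P Q M D : 'M[F]_m) :
  pencil_poly (P *m M *m Q) (P *m D *m Q) = (\det P * \det Q) *: pencil_poly M D.
Proof.
rewrite /pencil_poly !map_mxM [X in _ - X]scalemxAl [X in _ - X *m _]scalemxAr.
rewrite -mulmxBl -mulmxBr !det_mulmx !det_map_mx mulrAC -polyCM.
by rewrite mul_polyC.
Qed.

Lemma pencil_poly_diag (d : 'rV[F]_m) :
  pencil_poly (diag_mx d) 1%:M =
  (-1) ^+ m *: \prod_(a <- [seq d 0 i | i <- enum 'I_m]) ('X - a%:P).
Proof.
rewrite big_map big_enum /=.
transitivity (\det (diag_mx (\row_i ((d 0 i)%:P - 'X)))).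
  congr (\det _); apply/matrixP=> i j; rewrite !mxE rmorphMn /=.
  by case: eqP => [->|_]; rewrite ?mulr1n ?mulr0n ?mulr1 ?mulr0 ?subr0.
rewrite det_diag -mul_polyC rmorphXn rmorphN1 -[X in _ ^+ X](card_ord m) -prodrN.
by apply: eq_big => // i _; rewrite mxE opprB.
Qed.

Lemma mup_scale (a c : F) (p : {poly F}) : c != 0 -> mup a (c *: p) = mup a p.
Proof. by move=> c0; rewrite -mul_polyC mupMr // rootC. Qed.

Lemma mup_pencil_poly (M D P Q : 'M[F]_m) (d : 'rV[F]_m) a :
  P \in unitmx -> Q \in unitmx ->
  P *m M *m Q = diag_mx d -> P *m D *m Q = 1%:M ->
  mup a (pencil_poly M D) = #|[set i | d 0 i == a]|.
Proof.
rewrite !unitmxE !unitfE => P0 Q0 PMQ PDQ.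
rewrite -(mup_scale a (pencil_poly M D) (mulf_neq0 P0 Q0)).
rewrite -pencil_poly_congr PMQ PDQ pencil_poly_diag mup_scale ?signr_eq0 //.
by rewrite mu_prod_XsubC count_map -sum1_count big_enum_cond /= sum1dep_card.
Qed.

Lemma root_pencil_poly (M D P Q : 'M[F]_m) (d : 'rV[F]_m) a :
  P \in unitmx -> Q \in unitmx ->
  P *m M *m Q = diag_mx d -> P *m D *m Q = 1%:M ->
  root (pencil_poly M D) a = (a \in [seq d 0 i | i <- enum 'I_m]).
Proof.
rewrite !unitmxE !unitfE => P0 Q0 PMQ PDQ.
rewrite -(rootZ _ _ (mulf_neq0 P0 Q0)) -pencil_poly_congr PMQ PDQ.
by rewrite pencil_poly_diag rootZ ?signr_eq0 // root_prod_XsubC.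
Qed.

End PencilPolynomial.

Local Open Scope complex_scope.

(** Grouping the positive diagonal entries by value gives the distinct positive
eigenvalues, and the size of each group is the multiplicity as a root. *)
Lemma positive_eigenvalue_count (R : realType) m (M D : 'M[R]_m)
    (T : 'M[R[i]]_m) (d : 'rV[R[i]]_m) k :
    T \in unitmx ->
    T ^t* *m complexify M *m T = diag_mx d ->
    T ^t* *m complexify D *m T = 1%:M ->
  has_positive_eigenvalues M D k <-> #|positive_indices d| = k.
Proof.
move=> Tunit MT DT.
have T'unit : T ^t* \in unitmx.
  by have [] := mulmx1_unit DT; rewrite unitmx_mul => /andP[].
set p := pencil_poly (complexify M) (complexify D).
have mupE a : mup a p = (\sum_i (d 0%R i == a))%N.
  rewrite (mup_pencil_poly _ T'unit Tunit MT DT) -sum1_card big_mkcond.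
  by apply: eq_bigr => i _; rewrite inE; case: eqP.
have eigE a : pencil_eigenvalue (complexify M) (complexify D) a <->
    exists i, d 0 i = a.
  rewrite pencil_eigenvalue_root (root_pencil_poly _ T'unit Tunit MT DT).
  split=> [/mapP[i _ ->]|[i <-]]; first by exists i.
  by rewrite map_f // mem_enum.
have sumE (s : seq R[i]) : uniq s ->
    (forall a, a \in s <->
       pencil_eigenvalue (complexify M) (complexify D) a /\ 0 < a) ->
    (\sum_(a <- s) mup a p)%N = #|positive_indices d|.
  move=> s_uniq sP; rewrite (eq_bigr _ (fun a _ => mupE a)) exchange_big /=.
  rewrite -sum1_card [RHS]big_mkcond; apply: eq_bigr => i _.
  rewrite -[RHS]/(nat_of_bool (i \in positive_indices d)).
  have -> : (i \in positive_indices d) = (d 0 i \in s).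
    rewrite inE; apply/idP/idP => [di|/sP[] //].
    by apply/sP; split=> //; apply/eigE; exists i.
  have <- := count_uniq_mem (d 0 i) s_uniq; rewrite -sum1_count [RHS]big_mkcond.
  by apply: eq_bigr => a _; rewrite /= eq_sym; case: (a == _).
split=> [[s [s_uniq sP <-]]|<-]; first by rewrite sumE.
exists (undup [seq d 0 i | i <- enum (positive_indices d)]).
have sP a : a \in undup [seq d 0 i | i <- enum (positive_indices d)] <->
    pencil_eigenvalue (complexify M) (complexify D) a /\ 0 < a.
  rewrite mem_undup eigE; split=> [/mapP[j]|[[i <-] di]].
    by rewrite mem_enum inE => dj ->; split=> //; exists j.
  by apply/map_f; rewrite mem_enum inE.
by split; rewrite ?undup_uniq // sumE ?undup_uniq.
Qed.

(** * Real symmetric matrices over the complex numbers *)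

Local Open Scope classical_set_scope.

Section Complexification.
Variable R : realType.

Lemma complexifyM m n p (A : 'M[R]_(m, n)) (B : 'M[R]_(n, p)) :
  complexify (A *m B) = complexify A *m complexify B.
Proof. exact: map_mxM. Qed.

Lemma trmxC_complexify m n (A : 'M[R]_(m, n)) :
  (complexify A) ^t* = complexify A^T.
Proof. by apply/matrixP=> i j; rewrite !mxE; apply: conjc_real. Qed.

Lemma hermitian_form_complexify m (M : 'M[R]_m) (u : 'cV[R]_m) :
  hermitian_form (complexify M) (complexify u) = ((u^T *m M *m u) 0 0)%:C.
Proof. by rewrite /hermitian_form trmxC_complexify -!complexifyM mxE. Qed.

Lemma complexify_rect m (x : 'cV[R[i]]_m) :
  x = complexify (map_mx (@complex.Re R) x) +
      'i%C *: complexify (map_mx (@complex.Im R) x).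
Proof. by apply/matrixP=> i j; rewrite !mxE {1}[x i j]complexE. Qed.

(** For symmetric [M] the cross terms [i (u^T M v - v^T M u)] cancel, so a
complex vector sees only the values of the form at its real and imaginary
parts. *)
Lemma hermitian_form_rect m (M : 'M[R]_m) (u v : 'cV[R]_m) : M^T = M ->
  hermitian_form (complexify M) (complexify u + 'i%C *: complexify v) =
  ((u^T *m M *m u) 0 0 + (v^T *m M *m v) 0 0)%:C.
Proof.
move=> Msym; have uv : u^T *m M *m v = v^T *m M *m u.
  have -> : v^T *m M *m u = (u^T *m M *m v)^T.
    by rewrite !trmx_mul trmxK Msym mulmxA.
  by apply/matrixP=> i j; rewrite !ord1 [RHS]mxE.
rewrite /hermitian_form.
have -> : (complexify u + 'i%C *: complexify v) ^t* =
    complexify u^T - 'i%C *: complexify v^T.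
  apply/matrixP=> i j; rewrite !mxE rmorphD rmorphM /= -mulNr; congr (_ + _ * _).
  - exact: conjc_real.
  - by apply/eqP; rewrite eq_complex /= oppr0 !eqxx.
  - exact: conjc_real.
rewrite mulmxDr !mulmxBl -!scalemxAl -!scalemxAr -!complexifyM uv.
rewrite scalerA -expr2 sqr_i scaleN1r opprK.
rewrite addrA subrK.
by rewrite rmorphD /= !mxE.
Qed.

Lemma posdefmx_complexify m (D : 'M[R]_m) : D^T = D -> posdefmx D ->
  hermitian_posdef (complexify D).
Proof.
move=> Dsym Dpos x x0; rewrite [x]complexify_rect hermitian_form_rect //.
set u := map_mx _ x; set v := map_mx _ x.
have ge0 (w : 'cV[R]_m) : 0 <= (w^T *m D *m w) 0 0.
  by have [->|/Dpos/ltW//] := eqVneq w 0; rewrite mulmx0 mxE.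
rewrite ltcR; have [u0|/Dpos u_gt0] := eqVneq u 0; last by rewrite ltr_pwDl.
have [v0|/Dpos v_gt0] := eqVneq v 0; last by rewrite ltr_wpDl.
case/eqP: x0; rewrite [x]complexify_rect -/u -/v u0 v0.
by rewrite /complexify !map_mx0 scaler0 addr0.
Qed.

(** The real part of [x^* N x] is the Hermitian part of the form, and the sign
of that does not change when [x] is normalized. *)
Lemma field_of_values_left m (N : 'M[R]_m) :
  field_of_values N `<=` @open_left_half_plane R <-> posdefmx (- (N + N^T)).
Proof.
set H := - (N + N^T).
have Hsym : H^T = H by rewrite /H linearN linearD /= trmxK addrC.
have formE x : hermitian_form (complexify H) x =
    (- (complex.Re (hermitian_form (complexify N) x) *+ 2))%:C.
  have -> : complexify H = - (complexify N + (complexify N) ^t*).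
    by rewrite trmxC_complexify /complexify map_mxN map_mxD.
  transitivity (- (hermitian_form (complexify N) x +
                   hermitian_form ((complexify N) ^t*) x)).
    by rewrite /hermitian_form mulmxN mulNmx mulmxDr mulmxDl !mxE.
  rewrite -hermitian_form_conj; case: (hermitian_form _ x) => a b.
  by apply/eqP; rewrite eq_complex /= mulr2n subrr oppr0 !eqxx.
split=> [sub u u0|Hpos _ [x x1 ->]]; last first.
  have x0 : x != 0.
    apply/eqP => x0; move: x1; rewrite x0 /euclidean_norm big1 => [/eqP|i _].
      by rewrite sqrtC0 eq_sym oner_eq0.
    by rewrite mxE normr0 expr0n.
  have := posdefmx_complexify Hsym Hpos x0; rewrite formE ltcR oppr_gt0.
  by rewrite pmulrn_llt0.
set x := complexify u; set c := euclidean_norm x.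
have sum_ge0 : 0 <= \sum_(i < m) `|x i 0| ^+ 2.
  by apply: sumr_ge0 => i _; rewrite exprn_ge0.
have c_gt0 : 0 < c.
  rewrite /c /euclidean_norm sqrtC_gt0 lt_def sum_ge0 andbT.
  apply: contraNneq u0 => /psumr_eq0P x0; apply/eqP/colP=> i; rewrite mxE.
  have /eqP := x0 (fun i _ => exprn_ge0 _ (normr_ge0 _)) i isT.
  by rewrite expf_eq0 normr_eq0 !mxE /= fmorph_eq0 => /eqP.
have norm_y : euclidean_norm (c^-1 *: x) = 1.
  rewrite /euclidean_norm -sqrtC1; congr sqrtC.
  transitivity (c ^- 2 * \sum_(i < m) `|x i 0| ^+ 2).
    rewrite mulr_sumr; apply: eq_bigr => i _.
    by rewrite mxE normrM exprMn ger0_norm ?invr_ge0 ?ltW // exprVn.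
  rewrite -[X in _ * X]sqrtCK -/(euclidean_norm x) -/c.
  by rewrite mulVf // expf_neq0 // gt_eqF.
have : 0 < hermitian_form (complexify H) (c^-1 *: x).
  rewrite formE ltcR oppr_gt0 pmulrn_llt0 //.
  by apply: sub; exists (c^-1 *: x).
rewrite hermitian_form_scale pmulr_rgt0 ?hermitian_form_complexify ?ltcR //.
by rewrite exprn_gt0 // normr_gt0 invr_eq0 gt_eqF.
Qed.

(** Sylvester's law of inertia as dimension bounds on the number [p] of positive
eigenvalues, which do not involve [D].  The left inverse [L] expresses that
the columns of [E] are independent. *)
Lemma positive_inertia m (M D : 'M[R]_m) :
    M^T = M -> D^T = D -> posdefmx D ->
  exists p, [/\ forall k, has_positive_eigenvalues M D k <-> p = k,
    forall k (E : 'M[R]_(m, k)), posdefmx (E^T *m M *m E) -> (k <= p)%N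
  & forall k (E : 'M[R]_(m, k)) L, L *m E = 1%:M ->
      (forall x : 'cV_k, (x^T *m (E^T *m M *m E) *m x) 0 0 <= 0) ->
      (k + p <= m)%N].
Proof.
move=> Msym Dsym Dpos.
have Mh : (complexify M) ^t* = complexify M by rewrite trmxC_complexify Msym.
have Dh : (complexify D) ^t* = complexify D by rewrite trmxC_complexify Dsym.
have [T Tunit [d dreal [MT DT]]] :=
  simultaneous_diagonalization Mh Dh (posdefmx_complexify Dsym Dpos).
have formE k (E : 'M[R]_(m, k)) x :
    hermitian_form (complexify M) (complexify E *m x) =
    hermitian_form (complexify (E^T *m M *m E)) x.
  by rewrite hermitian_form_mul trmxC_complexify -!complexifyM.
have Esym k (E : 'M[R]_(m, k)) : (E^T *m M *m E)^T = E^T *m M *m E.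
  by rewrite !trmx_mul trmxK Msym mulmxA.
exists #|positive_indices d|; split=> [k|k E Epos|k E L LE Eneg].
- exact: positive_eigenvalue_count Tunit MT DT.
- apply: (posdef_subspace_bound Tunit dreal MT (E := complexify E)) => x x0.
  by rewrite formE; apply: posdefmx_complexify.
- apply: (nonpos_subspace_bound Tunit MT (E := complexify E)) => x.
    move/(congr1 (mulmx (complexify L))); rewrite mulmx0 mulmxA -complexifyM LE.
    by rewrite /complexify map_mx1 mul1mx.
  rewrite formE [x]complexify_rect hermitian_form_rect // lecR.
  by rewrite -[leRHS]addr0 lerD.
Qed.

End Complexification.

(** * Finsler's lemma and the equivalence *)

Lemma sqnorm_gt0 (F : realFieldType) n (x : 'cV[F]_n) :
  x != 0 -> 0 < (x^T *m x) 0 0.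
Proof.
have -> : (x^T *m x) 0 0 = \sum_i x i 0 ^+ 2.
  by rewrite mxE; apply: eq_bigr => i _; rewrite mxE.
rewrite lt_def sumr_ge0 ?andbT => [x0|i _]; last exact: sqr_ge0.
apply: contraNneq x0 => /psumr_eq0P x0; apply/eqP/colP=> i; rewrite mxE.
have /eqP := x0 (fun i _ => sqr_ge0 _) i isT.
by rewrite sqrf_eq0 => /eqP.
Qed.

(** Take an idempotent [Q = Z B^T] with the same kernel as [B^T] and let
[P = 1 - Q], which maps into that kernel.  As [B Z^T = Q^T], the terms
[B K + (B K)^T] can cancel all of [H] except [P^T H P] and add [Q^T Q]; what is
left is positive, since [Q x = x] as soon as [P x = 0]. *)
Lemma finsler_feedback (F : realFieldType) n q (H : 'M[F]_n) (B : 'M[F]_(n, q)) :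
    H^T = H ->
    (forall x : 'cV_n, x != 0 -> B^T *m x = 0 -> 0 < (x^T *m H *m x) 0 0) ->
  exists K : 'M[F]_(q, n), forall x : 'cV_n, x != 0 ->
    0 < (x^T *m (H + B *m K + (B *m K)^T) *m x) 0 0.
Proof.
move=> Hsym Hker.
have [Z BZB] : exists Z, B^T *m Z *m B^T = B^T.
  by exists (pinvmx B^T); rewrite mulmxKpV ?submx_refl.
have [Q QT [P PQ BP]] : exists2 Q, B *m Z^T = Q^T &
    exists2 P, P + Q = 1%:M & B^T *m P = 0.
  exists (Z *m B^T); first by rewrite trmx_mul trmxK.
  exists (1%:M - Z *m B^T); first exact: subrK.
  by rewrite mulmxBr mulmx1 mulmxA BZB subrr.
(* In [H + B K + (B K)^T], the term [- H P] of [K] removes both blocks mixing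
   [P] and [Q]; the symmetric term, counted twice and hence halved, replaces
   [Q^T H Q] by [Q^T Q]. *)
exists (Z^T *m (2^-1 *: (Q - H *m Q) - H *m P)) => x x0.
set G := (X in _ *m X *m _).
have GE : G = P^T *m H *m P + Q^T *m Q.
  have HE : H = P^T *m H *m P + P^T *m H *m Q + (Q^T *m H *m P + Q^T *m H *m Q).
    rewrite -!mulmxDr PQ !mulmx1 -mulmxDl.
    by rewrite -[P^T + _]linearD /= PQ trmx1 mul1mx.
  rewrite /G mulmxA QT mulmxBr -scalemxAr mulmxBr !mulmxA.
  rewrite [(_ - _)^T]linearB /= [(_ *: _)^T]linearZ /= [(_ - _)^T]linearB /=.
  rewrite !trmx_mul trmxK Hsym !mulmxA {1}HE.
  move: (P^T *m H *m P) (P^T *m H *m Q) (Q^T *m H *m P) (Q^T *m H *m Q).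
  move: (Q^T *m Q).
  by move=> f a b c e; apply/matrixP=> i j; rewrite !mxE; lra.
have -> : (x^T *m G *m x) 0 0 =
    ((P *m x)^T *m H *m (P *m x)) 0 0 + ((Q *m x)^T *m (Q *m x)) 0 0.
  by rewrite GE mulmxDr mulmxDl mxE !trmx_mul !mulmxA.
have [Px0|Px0] := eqVneq (P *m x) 0; last first.
  rewrite ltr_pwDl ?Hker //; first by rewrite mulmxA BP mul0mx.
  by have [->|/sqnorm_gt0/ltW//] := eqVneq (Q *m x) 0; rewrite mulmx0 mxE.
have Qx : Q *m x = x by rewrite -[RHS]mul1mx -PQ mulmxDl Px0 add0r.
by rewrite Px0 mulmx0 mxE add0r Qx sqnorm_gt0.
Qed.

(* [eigenvalue] is defined through row vectors (v *m A = a *: v); for a square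
   matrix this gives the usual eigenvalues. *)
Theorem theorem3p4 (R : realType) (n q : nat)
    (n_gt0 : (0 < n)%N) (q_gt0 : (0 < q)%N) (q_lt_n : (q < n)%N)
    (A : 'M[R]_n) (B : 'M[R]_(n, q))
    (A_stable : [set a | eigenvalue (complexify A) a] `<=` @open_left_half_plane R)
    (WA_right : field_of_values A `&` @open_right_half_plane R !=set0) :
  let M : 'M[R]_(n + q) := block_mx (- (A + A^T)) B B^T 0 in
  (exists K : 'M[R]_(q, n),
     field_of_values (A - B *m K) `<=` @open_left_half_plane R)
  <->
  (exists D : 'M[R]_(n + q),
     [/\ D^T = D, posdefmx D & has_positive_eigenvalues M D n]).
Proof.
move=> M; pose H := - (A + A^T).
have Hsym : H^T = H by rewrite /H linearN linearD /= trmxK addrC.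
have Msym : M^T = M by rewrite /M tr_block_mx trmxK trmx0 -/H Hsym.
have closed_loop K :
    - (A - B *m K + (A - B *m K)^T) = H + B *m K + (B *m K)^T.
  by rewrite /H linearB /= addrACA !opprD !opprK addrA.
split=> [[K /field_of_values_left]|[D [Dsym Dpos]]].
  rewrite closed_loop => Gpos.
  have Dpos : posdefmx (1%:M : 'M[R]_(n + q)).
    by move=> x x0; rewrite mulmx1 sqnorm_gt0.
  have [p [pP pos_le neg_le]] := positive_inertia Msym (trmx1 _ _) Dpos.
  exists 1%:M; split; rewrite ?trmx1 //; apply/pP/eqP; rewrite eqn_leq.
  apply/andP; split.
    rewrite -(leq_add2l q) [leqRHS]addnC.
    apply: (neg_le q (col_mx 0 1%:M) (row_mx 0 1%:M)).
      by rewrite mul_row_col mul0mx mulmx1 add0r.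
    move=> x; rewrite tr_col_mx trmx0 trmx1 /M mul_row_block mul_row_col.
    by rewrite !mul0mx !mul1mx !mulmx0 !mulmx1 !add0r mulmx0 mul0mx mxE.
  apply: (pos_le n (col_mx 1%:M K)).
  rewrite tr_col_mx trmx1 /M mul_row_block mul_row_col -/H.
  rewrite !mul1mx mulmx1 mulmx0 addr0.
  by rewrite -trmx_mul addrAC.
have [p [pP _ neg_le]] := positive_inertia Msym Dsym Dpos.
move=> /pP pn; rewrite {p}pn in pP neg_le.
have Hker (x : 'cV_n) : x != 0 -> B^T *m x = 0 -> 0 < (x^T *m H *m x) 0 0.
  move=> x0 Bx; rewrite ltNge; apply/negP => xHx.
  (* The columns of [block_mx x 0 0 1%:M] span the vectors [(t x, y)]. *)
  have := neg_le (1 + q)%N (block_mx x 0 0 1%:M)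
    (block_mx (pinvmx x^T)^T 0 0 1%:M).
  have xTB : x^T *m B = 0 by rewrite -[B]trmxK -trmx_mul Bx trmx0.
  have x_inv : (pinvmx x^T)^T *m x = 1%:M.
    have /mulmxVp/(congr1 trmx) : row_free x^T.
      by rewrite /row_free rank_rV trmx_eq0 x0.
    by rewrite trmx_mul trmxK trmx1.
  have -> : (block_mx x 0 0 1%:M)^T *m M *m block_mx x 0 0 1%:M =
      block_mx (x^T *m H *m x) 0 0 (0 : 'M_q).
    rewrite tr_block_mx !trmx0 trmx1 /M !mulmx_block -/H.
    by rewrite !(mul0mx, mulmx0, mul1mx, mulmx1, addr0, add0r) xTB Bx.
  rewrite mulmx_block x_inv !(mul0mx, mulmx0, mulmx1, addr0, add0r).
  rewrite -scalar_mx_block -addnA [(q + n)%N]addnC addnA => /(_ erefl).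
  have neg (w : 'cV_(1 + q)) :
      (w^T *m block_mx (x^T *m H *m x) 0 0 (0 : 'M_q) *m w) 0 0 <= 0.
    rewrite -[w]vsubmxK tr_col_mx mul_row_block mul_row_col.
    rewrite !(mul0mx, mulmx0, addr0, add0r) [x^T *m H *m x]mx11_scalar.
    rewrite mul_mx_scalar -scalemxAl mxE mulr_le0_ge0 //.
    by have [->|/sqnorm_gt0/ltW//] := eqVneq (usubmx w) 0; rewrite mulmx0 mxE.
  by move=> /(_ neg); rewrite ltnn.
have [K Kpos] := finsler_feedback Hsym Hker.
by exists K; apply/field_of_values_left; rewrite closed_loop.
Qed.
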